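(* Let $n\ge1$. For $0\le\theta_1\le\cdots\le\theta_n\le\pi$ put $$p(x)=\prod_{j=1}^n(x-\cos\theta_j),\qquad f(x)=\sqrt{1-x^2}\;p(x),$$ $$M(\cos\theta_1,\ldots,\cos\theta_n)=\sqrt{\prod_{j=1}^n(1-\cos^2\theta_j)}\;\prod_{1\le j<k\le n}|\cos\theta_j-\cos\theta_k|.$$ If $(\theta_1,\ldots,\theta_n)$ is a point at which $M$ attains its maximum over all $0\le\theta_1\le\cdots\le\theta_n\le\pi$, then $f$ satisfies the ordinary differential equation $$f''(x)=\frac{-(n^2+n)\left[(1-x^2)+\frac{1}{n^2+n}\right]}{(1-x^2)^2}\,f(x)$$ for $x\in(-1,1)$.
   Context: The product $\prod_{j<k}|\cos\theta_j-\cos\theta_k|$ is the nonnegative square root of the discriminant of $p$. (Up to a constant factor, $M^2$ is the volume of the conjugacy class in the compact symplectic group $Sp(2n)=SU(2n)\cap Sp(2n,\mathbb C)$ with eigenvalues $e^{\pm i\theta_1},\ldots,e^{\pm i\theta_n}$.) *)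

(* Defs.v *)
From HB Require Import structures.
From mathcomp Require Import all_boot all_order all_algebra.
From mathcomp Require Import all_classical all_reals all_analysis.

Set Implicit Arguments.
Unset Strict Implicit.
Unset Printing Implicit Defensive.

Import Order.TTheory GRing.Theory Num.Theory.
Import numFieldNormedType.Exports.

Local Open Scope ring_scope.

Definition angle_domain (R : realType) (n : nat) (theta : 'I_n -> R) : Prop :=
  (forall j, 0 <= theta j <= pi) /\
  (forall j k : 'I_n, (j <= k)%N -> theta j <= theta k).

Definition p_of (R : realType) (n : nat) (theta : 'I_n -> R) : {poly R} :=
  \prod_(j < n) ('X - (cos (theta j))%:P).

(* [Num.sqrt] is 0 on negative reals, so [f_of] vanishes outside [-1, 1]. *)
Definition f_of (R : realType) (n : nat) (theta : 'I_n -> R) (x : R) : R :=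
  Num.sqrt (1 - x ^+ 2) * (p_of theta).[x].

Definition M_of (R : realType) (n : nat) (x : 'I_n -> R) : R :=
  Num.sqrt (\prod_(j < n) (1 - x j ^+ 2)) *
  \prod_(j < n) \prod_(k < n | (j < k)%N) `|x j - x k|.

(* Main.v *)
(* At a maximizing configuration M is positive, so the nodes cos theta_j are
   distinct and interior and each angle may be varied on its own.  As a function
   of the j-th angle alone, M^2 is a positive multiple of (1 - t^2) q(t)^2 at
   t = cos theta_j, where p = (X - cos theta_j) q; stationarity is Stieltjes'
   condition that (1 - x^2) p'' - 2 x p' vanishes at every root of p.  Hence
   (1 - x^2) p'' - 2 x p' + n (n + 1) p, whose coefficient of degree n cancels,
   has n distinct roots and is zero: p satisfies Legendre's equation, which is
   the stated equation for f = sqrt (1 - x^2) p. *)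
Require Import Defs.
From HB Require Import structures.
From mathcomp Require Import all_boot all_order all_algebra.
From mathcomp Require Import all_classical all_reals all_analysis.
From mathcomp Require Import ring lra.

Set Implicit Arguments.
Unset Strict Implicit.
Unset Printing Implicit Defensive.

Import Order.TTheory GRing.Theory Num.Theory.
Import numFieldNormedType.Exports.

Local Open Scope ring_scope.

Lemma legendre_of_roots (R : idomainType) (n : nat) (p : {poly R}) (c : 'I_n -> R) :
    injective c -> (size p <= n.+1)%N -> (forall j, root p (c j)) ->
    (forall j, (1 - c j ^+ 2) * p^`()^`().[c j] = 2 * c j * p^`().[c j]) ->
  forall x, (1 - x ^+ 2) * p^`()^`().[x] - 2 * x * p^`().[x]
            + (n%:R ^+ 2 + n%:R) * p.[x] = 0.
Proof.
move=> cinj szp rootp crit.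
pose L : {poly R} := p^`()^`() - p^`()^`() * 'X^2 - (p^`() * 'X) *+ 2
                     + (n%:R ^+ 2 + n%:R) *: p.
have hornerL x : L.[x] = (1 - x ^+ 2) * p^`()^`().[x] - 2 * x * p^`().[x]
            + (n%:R ^+ 2 + n%:R) * p.[x].
  by rewrite /L !hornerE /=; ring.
suff L0 : L = 0 by move=> x; rewrite -hornerL L0 horner0.
apply: (@roots_geq_poly_eq0 _ _ [seq c j | j : 'I_n]).
- apply/allP => _ /mapP[j _ ->]; rewrite rootE hornerL crit (rootP (rootp j)).
  by rewrite mulr0 addr0 subrr.
- by rewrite map_inj_uniq ?enum_uniq.
(* The coefficient of [L] in degree i is (i+2)(i+1) p_{i+2} + (n(n+1) - i(i+1)) p_i. For i >= n the
   first term lies beyond the size of [p]; the second vanishes by its factor if i = n and because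
   p_i = 0 if i > n. Degrees 0 and 1 are separate because of the shifts by 'X and 'X^2. *)
- rewrite size_map size_enum_ord; apply/leq_sizeP => i nLi.
  have p0 k : (n < k)%N -> p`_k = 0 by move=> nk; rewrite nth_default// (leq_trans szp).
  rewrite /L !(coefD, coefN, coefMn, coefZ, coefMXn, coefMX, coef_deriv).
  have pi2 := p0 i.+2 (leqW nLi).
  case: i nLi pi2 => [|[|i]] /= nLi ->.
  + by move: nLi; rewrite leqn0 => /eqP ->; ring.
  + move: nLi; rewrite leq_eqVlt => /orP[/eqP->|/p0 ->]; ring.
  + rewrite !subSS subn0.
    move: nLi; rewrite leq_eqVlt => /orP[/eqP->|/p0 ->]; ring.
Qed.

(** The last bracket is free of [x j], so it stays constant when only the [j]-th node moves. *)
Lemma M_of_isolate (R : realType) (n : nat) (x : 'I_n -> R) (j : 'I_n) :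
    0 <= 1 - x j ^+ 2 ->
  M_of x = Num.sqrt (1 - x j ^+ 2) * `|\prod_(k < n | k != j) (x j - x k)| *
    (Num.sqrt (\prod_(k < n | k != j) (1 - x k ^+ 2)) *
     \prod_(i < n | i != j) \prod_(k < n | (i < k)%N && (k != j)) `|x i - x k|).
Proof.
move=> xj; rewrite /M_of (bigD1 j) //= sqrtrM // -!mulrA; congr (_ * _).
rewrite mulrCA; congr (_ * _); rewrite (bigD1 j) //=.
have splitj i : i != j -> \prod_(k < n | (i < k)%N) `|x i - x k| =
    (if (i < j)%N then `|x i - x j| else 1) *
    \prod_(k < n | (i < k)%N && (k != j)) `|x i - x k|.
  move=> ij; case: ltnP => [lt_ij|le_ji]; first by rewrite (bigD1 j).
  rewrite mul1r; apply: eq_bigl => k; case: (eqVneq k j) => [->|]; last by rewrite andbT.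
  by rewrite ltnNge le_ji.
rewrite (eq_bigr _ splitj) big_split /= mulrA; congr (_ * _).
(* The factors with k > j are row [j] of the double product; those with k < j were extracted from
   the other rows. *)
rewrite -big_mkcondr normr_prod [RHS](bigID (fun k : 'I_n => (j < k)%N)) /=.
congr (_ * _).
  by apply: eq_bigl => k; rewrite -val_eqE /=; case: ltngtP.
apply: eq_big => [k|k _]; last exact: distrC.
by rewrite -val_eqE /=; case: ltngtP.
Qed.

Lemma pi_fraction_itv (R : realType) (n : nat) (k : 'I_n) :
  0 < (pi : R) * (k.+1%:R / n.+1%:R) < pi.
Proof.
rewrite mulr_gt0 ?pi_gt0 ?divr_gt0 ?ltr0n //= gtr_pMr ?pi_gt0 //.
by rewrite ltr_pdivrMr ?ltr0n // mul1r ltr_nat ltnS.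
Qed.

Lemma sub1_cos_sqr (R : realType) (t : R) : 1 - cos t ^+ 2 = sin t ^+ 2.
Proof. by rewrite cos2sin2 opprB addrC subrK. Qed.

(** Equally spaced angles work. The shifts by one keep them off 0 and [pi], where the sine vanishes,
    and [cos] is injective on [0, pi]. *)
Lemma M_of_gt0_exists (R : realType) (n : nat) :
  exists2 phi : 'I_n -> R, angle_domain phi & 0 < M_of (fun j => cos (phi j)).
Proof.
pose phi (k : 'I_n) : R := pi * (k.+1%:R / n.+1%:R).
have phi_in k : phi k \in `[0, pi].
  by rewrite in_itv /=; have /andP[/ltW -> /ltW ->] := pi_fraction_itv R k.
have phi_mono j k : (phi j <= phi k) = (j <= k)%N.
  by rewrite /phi ler_pM2l ?pi_gt0 // ler_pM2r ?invr_gt0 ?ltr0n // ler_nat.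
exists phi; first by split=> [j|j k]; [have := phi_in j; rewrite in_itv | rewrite phi_mono].
apply: mulr_gt0.
  rewrite sqrtr_gt0; apply: prodr_gt0 => j _; rewrite sub1_cos_sqr exprn_gt0 //.
  exact/sin_gt0_pi/pi_fraction_itv.
apply: prodr_gt0 => j _; apply: prodr_gt0 => k jk; rewrite normr_gt0 subr_eq0.
apply/eqP => /cos_inj eq_jk.
by move: jk; rewrite ltnNge -phi_mono eq_jk ?lexx.
Qed.

(** Injectivity makes the order strict, so each of the finitely many constraints on the [j]-th angle
    is open and survives a small move. *)
Lemma angle_domain_near (R : realType) (n : nat) (theta : 'I_n -> R) (j : 'I_n) :
    angle_domain theta -> injective theta -> 0 < theta j < pi ->
  \forall s \near theta j, angle_domain (fun k => if k == j then s else theta k).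
Proof.
move=> [bnd mono] inj /andP[gt0 ltpi].
have mono_lt (k l : 'I_n) : (k < l)%N -> theta k < theta l.
  move=> kl; rewrite lt_neqAle mono ?(ltnW kl) // andbT.
  by apply/eqP => /inj ekl; rewrite ekl ltnn in kl.
have near_lt (k : 'I_n) : \forall s \near theta j, (k < j)%N -> theta k < s.
  case: (ltnP k j) => [kj|_]; last by near=> s.
  by apply: filterS (lt_nbhsr (mono_lt _ _ kj)).
have near_gt (k : 'I_n) : \forall s \near theta j, (j < k)%N -> s < theta k.
  case: (ltnP j k) => [jk|_]; last by near=> s.
  by apply: filterS (lt_nbhsl (mono_lt _ _ jk)).
near=> s.
have lts : forall k : 'I_n, (k < j)%N -> theta k < s.
  by near: s; apply: filter_forall.
have gts : forall k : 'I_n, (j < k)%N -> s < theta k.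
  by near: s; apply: filter_forall.
split=> [k|k l kl].
  case: eqP => _ //; apply/andP; split; apply: ltW; near: s;
    [exact: lt_nbhsr | exact: lt_nbhsl].
case: (eqVneq k j) (eqVneq l j) => [ekj|nkj] [elj|nlj] //; last exact: mono.
- have jl : (j < l)%N by rewrite ltn_neqAle -ekj kl andbT val_eqE ekj eq_sym.
  exact/ltW/gts.
- have kj : (k < j)%N by rewrite ltn_neqAle -elj kl andbT val_eqE elj.
  exact/ltW/lts.
Unshelve. all: by end_near. Qed.

Lemma M_of_gt0_inj_sin_neq0 (R : realType) (n : nat) (theta : 'I_n -> R) :
    0 < M_of (fun j => cos (theta j)) ->
  [/\ injective (fun j => cos (theta j)) & forall j, sin (theta j) != 0].
Proof.
move=> Mgt0; have Mj j := M_of_isolate (x := fun j => cos (theta j)) (j := j).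
split=> [k j /= ekj|j]; last first.
  move: Mgt0; rewrite (Mj j) /= sub1_cos_sqr ?sqr_ge0 //; apply: contraTneq => ->.
  by rewrite expr0n /= sqrtr0 !mul0r ltxx.
apply/eqP; apply: contraTT Mgt0 => nkj; rewrite (Mj j) /= sub1_cos_sqr ?sqr_ge0 //.
by rewrite (bigD1 k) //= ekj subrr mul0r normr0 mulr0 mul0r ltxx.
Qed.

(** This is Stieltjes' condition written with the cofactor [q]: at the [j]-th node, p' equals q and
    p'' equals 2 q'. *)
Lemma M_of_max_critical (R : realType) (n : nat) (theta : 'I_n -> R) (j : 'I_n)
    (q := \prod_(k < n | k != j) ('X - (cos (theta k))%:P)) :
    angle_domain theta ->
    (forall phi : 'I_n -> R, angle_domain phi ->
       M_of (fun j => cos (phi j)) <= M_of (fun j => cos (theta j))) ->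
    0 < M_of (fun j => cos (theta j)) ->
  (1 - cos (theta j) ^+ 2) * q^`().[cos (theta j)] =
    cos (theta j) * q.[cos (theta j)].
Proof.
move=> dom hmax Mgt0; have [cinj nz] := M_of_gt0_inj_sin_neq0 Mgt0.
have thinj : injective theta by move=> k l e; apply: cinj; rewrite /= e.
have th_in : 0 < theta j < pi.
  have [/(_ j)/andP[ge0 lepi] _] := dom.
  rewrite !lt_neqAle ge0 lepi !andbT eq_sym.
  by apply/andP; split; apply/eqP => e; have := nz j; rewrite -?e ?e ?sin0 ?sinpi eqxx.
pose upd s := fun k => if k == j then s else theta k.
(* Squaring the [j]-dependent factor [h] of M removes the square root and the absolute value,
   leaving a polynomial in [cos s]. *)
pose g : {poly R} := (1 - 'X^2) * q ^+ 2.
have [e e0 dom_upd] :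
    exists2 e : R, 0 < e & forall s, `|theta j - s| < e -> angle_domain (upd s).
  have /nbhs_ballP[e /= e0 He] := angle_domain_near dom thinj th_in.
  by exists e => // s; apply: He.
pose h s := Num.sqrt (1 - cos s ^+ 2) * `|q.[cos s]|.
have h2 s : h s ^+ 2 = (horner g \o cos) s.
  rewrite exprMn sqr_sqrtr ?sub1_cos_sqr ?sqr_ge0 // real_normK ?num_real //.
  by rewrite /g /= !hornerE -sub1_cos_sqr.
have h_ge0 s : 0 <= h s by rewrite mulr_ge0 ?sqrtr_ge0.
pose C := Num.sqrt (\prod_(k < n | k != j) (1 - cos (theta k) ^+ 2)) *
  \prod_(i < n | i != j) \prod_(k < n | (i < k)%N && (k != j))
     `|cos (theta i) - cos (theta k)|.
have M_upd s : M_of (fun k => cos (upd s k)) = h s * C.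
  rewrite (M_of_isolate (j := j)) /upd eqxx ?sub1_cos_sqr ?sqr_ge0 //.
  rewrite /h /C; congr (_ * _ * (_ * _)).
  - by rewrite sub1_cos_sqr.
  - rewrite /q horner_prod; congr `|_|; apply: eq_bigr => k /negPf ->.
    by rewrite !hornerE.
  - by congr Num.sqrt; apply: eq_bigr => k /negPf ->.
  - apply: eq_bigr => i /negPf ->; apply: eq_bigr => k /andP[_ /negPf ->] //.
have upd_id : upd (theta j) = theta.
  by apply/funext => k; rewrite /upd; case: eqVneq => [->|].
have C_gt0 : 0 < C.
  rewrite lt_neqAle eq_sym; apply/andP; split.
    by apply: contraTneq Mgt0 => C0; rewrite -upd_id M_upd C0 mulr0 ltxx.
  apply: mulr_ge0; first exact: sqrtr_ge0.
  by apply: prodr_ge0 => i _; apply: prodr_ge0.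
(* Maximality passes from M to [h] on dividing by [C], then to its square since [h] is
   nonnegative. *)
have gmax s : s \in `]theta j - e, theta j + e[ ->
    (horner g \o cos) s <= (horner g \o cos) (theta j).
  rewrite in_itv /= -ltr_distlC => s_near.
  have := hmax _ (dom_upd s s_near).
  rewrite -[in X in _ <= X]upd_id !M_upd ler_pM2r // => le_h.
  by rewrite -[horner _ _]h2 -[X in _ <= X]h2 lerXn2r ?nnegrE.
have crit : is_derive (theta j) 1 (horner g \o cos) 0.
  apply: derive1_at_max gmax => [|t _|]; first by lra.
    by apply: ex_derive; apply: is_derive1_comp.
  by rewrite in_itv /=; lra.
have := @is_derive1_comp _ (horner g) cos (theta j) _ _
  (is_derive_poly g _) (is_derive_cos _).
(* By the chain rule the zero derivative is g'(cos theta_j) times -sin theta_j, whose second factor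
   is nonzero. *)
move=> [_]; rewrite (derive_val (is_derive := crit)) => /esym/eqP.
rewrite mulf_eq0 oppr_eq0 (negPf (nz j)) orbF /g derivM derivB derivXn derivC deriv_exp.
rewrite !hornerE /= => /eqP g'0.
have q_neq0 : q.[cos (theta j)] != 0.
  rewrite /q horner_prod; apply/prodf_neq0 => k nkj.
  by rewrite !hornerE subr_eq0; apply: contra nkj => /eqP/cinj ->.
have q2_neq0 : 2 * q.[cos (theta j)] != 0 by rewrite mulf_neq0 ?pnatr_eq0.
apply: (mulfI q2_neq0).
apply/eqP; rewrite -subr_eq0; apply/eqP; rewrite -[RHS]g'0; ring.
Qed.

Lemma is_derive_sqrt_sub1sq (R : realType) (x : R) : -1 < x < 1 ->
  is_derive x 1 (fun y : R => Num.sqrt (1 - y ^+ 2)) (- x / Num.sqrt (1 - x ^+ 2)).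
Proof.
move=> /andP[x1 x2]; have w0 : 0 < 1 - x ^+ 2 by nra.
have H : is_derive x 1 (horner (1 - 'X^2)) (- (2 * x)).
  apply: is_derive_eq (is_derive_poly _ _) _.
  by rewrite derivB derivC derivXn !hornerE /=; ring.
have Hs : is_derive (horner (1 - 'X^2) x) 1 Num.sqrt (2 * Num.sqrt (1 - x ^+ 2))^-1.
  by rewrite !hornerE; apply: is_derive1_sqrt.
have -> : (fun y : R => Num.sqrt (1 - y ^+ 2)) = Num.sqrt \o horner (1 - 'X^2).
  by apply/funext => y /=; rewrite !hornerE.
apply: is_derive_eq (is_derive1_comp Hs H) _.
have : Num.sqrt (1 - x ^+ 2) != 0 by rewrite gt_eqF ?sqrtr_gt0.
by move=> w; field.
Qed.

(** Pulling out the inverse square root leaves a polynomial factor, the form that the next lemma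
    differentiates again. *)
Lemma is_derive_sqrt_sub1sqM (R : realType) (p : {poly R}) (x : R) : -1 < x < 1 ->
  is_derive x 1 (fun y : R => Num.sqrt (1 - y ^+ 2) * p.[y])
    ((Num.sqrt (1 - x ^+ 2))^-1 * ((1 - 'X^2) * p^`() - 'X * p).[x]).
Proof.
move=> xb; have w0 : 0 < 1 - x ^+ 2 by move/andP: xb => [? ?]; nra.
apply: is_derive_eq (is_deriveM (is_derive_sqrt_sub1sq xb) (is_derive_poly p x)) _.
have w : Num.sqrt (1 - x ^+ 2) != 0 by rewrite gt_eqF ?sqrtr_gt0.
have := sqr_sqrtr (ltW w0); rewrite !hornerE /= /GRing.scale /=.
(* With the root generalized to a nonzero [w] and 1 - x^2 replaced by its square, the goal is a
   rational identity. *)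
by move: (Num.sqrt _) w => w w_neq0 <-; field.
Qed.

Lemma is_derive_inv_sqrt_sub1sqM (R : realType) (r : {poly R}) (x : R) : -1 < x < 1 ->
  is_derive x 1 (fun y : R => (Num.sqrt (1 - y ^+ 2))^-1 * r.[y])
    ((Num.sqrt (1 - x ^+ 2))^-1 * (x * r.[x] / (1 - x ^+ 2) + r^`().[x])).
Proof.
move=> xb; have w0 : 0 < 1 - x ^+ 2 by move/andP: xb => [? ?]; nra.
have w : Num.sqrt (1 - x ^+ 2) != 0 by rewrite gt_eqF ?sqrtr_gt0.
have dV := is_deriveV (f := fun y : R => Num.sqrt (1 - y ^+ 2)) w
  (is_derive_sqrt_sub1sq xb).
apply: is_derive_eq (is_deriveM dV (is_derive_poly r x)) _.
have := sqr_sqrtr (ltW w0); rewrite /GRing.scale /=.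
by move: (Num.sqrt _) w => w w_neq0 <-; field.
Qed.

Theorem theorem6p2 (R : realType) (n : nat) (theta : 'I_n -> R)
  (hn : (1 <= n)%N)
  (htheta : angle_domain theta)
  (hmax : forall phi : 'I_n -> R, angle_domain phi ->
     M_of (fun j => cos (phi j)) <= M_of (fun j => cos (theta j))) :
  forall x : R, -1 < x < 1 ->
    [/\ derivable (f_of theta) x 1,
        derivable (derive1 (f_of theta)) x 1 &
        derive1n 2 (f_of theta) x =
          - (n%:R ^+ 2 + n%:R) * ((1 - x ^+ 2) + 1 / (n%:R ^+ 2 + n%:R))
            / (1 - x ^+ 2) ^+ 2 * f_of theta x].
Proof.
have Mgt0 : 0 < M_of (fun j => cos (theta j)).
  by have [phi /hmax le_M gt0] := M_of_gt0_exists R n; apply: lt_le_trans le_M.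
have [cinj _] := M_of_gt0_inj_sin_neq0 Mgt0.
set p := p_of theta.
have legendre : forall x, (1 - x ^+ 2) * p^`()^`().[x] - 2 * x * p^`().[x]
    + (n%:R ^+ 2 + n%:R) * p.[x] = 0.
  apply: (legendre_of_roots cinj) => [|j|j].
  - by rewrite /p /p_of -big_enum size_prod_XsubC size_enum_ord.
  - rewrite rootE horner_prod; apply/prodf_eq0; exists j => //.
    by rewrite !hornerE subrr.
  - rewrite /p /p_of (bigD1 j) //=.
    have := M_of_max_critical j htheta hmax Mgt0; set q := \prod_(k < n | _) _ => crit.
    rewrite derivM derivXsubC mul1r derivD derivM derivXsubC mul1r !hornerE /=.
    lra.
have near_itv (x : R) : -1 < x < 1 -> \forall y \near x, -1 < y < 1.
  move=> xb; have := near_in_itvoo (a := -1) (b := 1) xb.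
  by apply: filterS => y; rewrite in_itv.
have f1 x : -1 < x < 1 -> derive1 (f_of theta) x =
    (Num.sqrt (1 - x ^+ 2))^-1 * ((1 - 'X^2) * p^`() - 'X * p).[x].
  by move=> xb; rewrite derive1E (derive_val (is_derive := is_derive_sqrt_sub1sqM p xb)).
move=> x xb.
(* Differentiating again needs the formula for f' on a whole neighbourhood of [x]. *)
have f1_near : \forall y \near x, (Num.sqrt (1 - y ^+ 2))^-1 *
    ((1 - 'X^2) * p^`() - 'X * p).[y] = derive1 (f_of theta) y.
  by apply: filterS (near_itv _ xb) => y /f1 ->.
have f2 := near_eq_is_derive f1_near
  (is_derive_inv_sqrt_sub1sqM ((1 - 'X^2) * p^`() - 'X * p) xb).
split; [by have [] := is_derive_sqrt_sub1sqM p xb | by have [] := f2 |].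
rewrite /= derive1E (derive_val (is_derive := f2)).
have w0 : 0 < 1 - x ^+ 2 by move/andP: xb => [? ?]; nra.
have w : Num.sqrt (1 - x ^+ 2) != 0 by rewrite gt_eqF ?sqrtr_gt0.
(* Here n >= 1 enters: the equation divides by n^2 + n. *)
have N0 : n%:R ^+ 2 + n%:R != 0 :> R.
  by rewrite gt_eqF // addr_gt0 ?exprn_gt0 ?ltr0n.
(* Both sides of the goal then carry the same inverse root. *)
have wV : Num.sqrt (1 - x ^+ 2) = (Num.sqrt (1 - x ^+ 2))^-1 * (1 - x ^+ 2).
  by rewrite -[X in _ = _ * X](sqr_sqrtr (ltW w0)) expr2 mulKf.
rewrite /f_of -/p [in RHS]wV.
have ddp : (1 - x ^+ 2) * p^`()^`().[x] =
    2 * x * p^`().[x] - (n%:R ^+ 2 + n%:R) * p.[x].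
  by apply/eqP; rewrite -subr_eq0; apply/eqP; rewrite -[RHS](legendre x); ring.
(* After p'' is eliminated, the terms in p' have coefficients x, -3x and 2x and cancel; what remains
   is -(n^2 + n + 1/(1 - x^2)) p. *)
rewrite derivB !derivM derivB derivX derivXn derivC !hornerE /= ddp.
by field; rewrite N0 w gt_eqF.
Qed.
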